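(* Let $M,d\ge1$ be integers, $\widetilde{x}\in\mathbb{R}^d$, $y\in[M]$, and define $$\mathcal{L}^1(W)=-\log\mathrm{softmax}_y(W\widetilde{x})\ \ (W\in\mathbb{R}^{M\times d}),\qquad \mathcal{L}^2(W_O,W_V)=-\log\mathrm{softmax}_y(W_OW_V\widetilde{x})\ \ (W_O\in\mathbb{R}^{M\times d},\ W_V\in\mathbb{R}^{d\times d}).$$ Let $(W_O(t),W_V(t))_{t\ge0}$ follow gradient flow on $\mathcal{L}^2$, i.e. $\dot W_O=-\nabla_{W_O}\mathcal{L}^2(W_O,W_V)$ and $\dot W_V=-\nabla_{W_V}\mathcal{L}^2(W_O,W_V)$, and let $\widetilde W_{OV}(t)=W_O(t)W_V(t)$. Assume $W_O(0)^\top W_O(0)=W_V(0)W_V(0)^\top$. Then for all $t\ge 0$, $$\frac{d}{dt}\operatorname{vec}\big(\widetilde W_{OV}(t)\big)=-\Omega\big(\widetilde W_{OV}(t)\big)\operatorname{vec}\big(\nabla\mathcal{L}^1(\widetilde W_{OV}(t))\big),$$ where $\Omega:\mathbb{R}^{M\times d}\to\mathbb{R}^{Md\times Md}$ is given by $$\Omega(C)=(C^\top C)^{1/2}\oplus(CC^\top)^{1/2}=(C^\top C)^{1/2}\otimes I_M+I_d\otimes(CC^\top)^{1/2}.$$ Moreover $\Omega$ is homogeneous of degree 1: $\Omega(cC)=c\,\Omega(C)$ for all $c\ge0$ and $C\in\mathbb{R}^{M\times d}$.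
   Context: $[M]=\{1,\dots,M\}$; $\mathrm{softmax}_i(u)=e^{u_i}/\sum_j e^{u_j}$. $\operatorname{vec}$ stacks the columns of a matrix; $\otimes$ is the Kronecker product and $\oplus$ the Kronecker sum, $A\oplus B=A\otimes I+I\otimes B$; $P^{1/2}$ is the positive semidefinite square root of a positive semidefinite matrix $P$. Gradients with respect to a matrix are matrices of the same shape (Frobenius inner product). In the source, $\widetilde{x}=X^\top a$ is the attended representation, where $X\in\mathbb{R}^{T\times d}$ is the token matrix and $a\in\mathbb{R}^T$ is an attention vector that is held fixed when training $W_O,W_V$. *)

(* Defs.v *)
From HB Require Import structures.
From mathcomp Require Import all_boot all_order all_algebra.
From mathcomp Require Import all_classical all_reals all_analysis.
From mathcomp Require Export mxtens.

Set Implicit Arguments.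
Unset Strict Implicit.
Unset Printing Implicit Defensive.

Import Order.TTheory GRing.Theory Num.Theory.
Import numFieldNormedType.Exports.

Local Open Scope classical_set_scope.
Local Open Scope ring_scope.

Definition softmax (R : realType) (M : nat) (u : 'cV[R]_M) (i : 'I_M) : R :=
  expR (u i 0) / \sum_(j < M) expR (u j 0).

Definition loss1 (R : realType) (M d : nat) (x : 'cV[R]_d) (y : 'I_M)
    (W : 'M[R]_(M, d)) : R :=
  - ln (softmax (W *m x) y).

Definition loss2 (R : realType) (M d : nat) (x : 'cV[R]_d) (y : 'I_M)
    (WO : 'M[R]_(M, d)) (WV : 'M[R]_d) : R :=
  - ln (softmax (WO *m WV *m x) y).

(* The matrix representing the Frechet differential of f at W for the
   Frobenius inner product, see gradientP. *)
Definition gradient (R : realType) (m n : nat) (f : 'M[R]_(m, n) -> R)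
    (W : 'M[R]_(m, n)) : 'M[R]_(m, n) :=
  \matrix_(i < m, j < n) 'd f W (delta_mx i j).

Lemma gradientP (R : realType) (m n : nat) (f : 'M[R]_(m, n) -> R)
    (W H : 'M[R]_(m, n)) :
  'd f W H = \tr ((gradient f W)^T *m H).
Proof.
rewrite {1}(matrix_sum_delta H) linear_sum.
transitivity (\sum_i \sum_j H i j * gradient f W i j).
  apply: eq_bigr => i _; rewrite linear_sum; apply: eq_bigr => j _.
  by rewrite mxE linearZ.
rewrite exchange_big /mxtrace; apply: eq_bigr => j _ /=.
by rewrite mxE; apply: eq_bigr => i _; rewrite [in RHS]mxE mulrC.
Qed.

(* Derivative at t of a curve on [0, +oo[: two-sided for 0 < t and one-sided
   from the right at t = 0; values of f at negative times are irrelevant. *)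
Definition is_derive_ge0 (R : realType) (V : normedModType R) (f : R -> V)
    (t : R) (df : V) : Prop :=
  (s - t)^-1 *: (f s - f t) @[s --> within [set s | 0 <= s] t^'] --> df.

(* Column stacking: A i j is the entry at position j * m + i, that is, at
   mxtens_index (j, i), so that vec matches the block structure of *t. *)
Definition vec (T : Type) (m n : nat) (A : 'M[T]_(m, n)) : 'cV[T]_(n * m) :=
  \col_(k < n * m) A (mxtens_unindex k).2 (mxtens_unindex k).1.

Lemma vecE (T : Type) (m n : nat) (A : 'M[T]_(m, n)) (i : 'I_m) (j : 'I_n) :
  vec A (mxtens_index (j, i)) 0 = A i j.
Proof. by rewrite mxE mxtens_indexK. Qed.

Definition kronecker_sum (R : realType) (m n : nat) (A : 'M[R]_m)
    (B : 'M[R]_n) : 'M[R]_(m * n) :=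
  A *t (1%:M : 'M[R]_n) + (1%:M : 'M[R]_m) *t B.

Definition psd (R : realType) (n : nat) (A : 'M[R]_n) : Prop :=
  A^T = A /\ forall v : 'cV[R]_n, 0 <= (v^T *m A *m v) 0 0.

(* For psd P, by the spectral theorem, the set below is a singleton; the
   default value 0 only matters when P is not psd. *)
Definition psd_sqrt (R : realType) (n : nat) (P : 'M[R]_n) : 'M[R]_n :=
  xget 0 [set S : 'M[R]_n | psd S /\ S *m S = P].

Definition Omega (R : realType) (M d : nat) (C : 'M[R]_(M, d)) :
    'M[R]_(d * M) :=
  kronecker_sum (psd_sqrt (C^T *m C)) (psd_sqrt (C *m C^T)).

(* Main.v *)
From HB Require Import structures.
Require Import Defs.
From mathcomp Require Import all_boot all_order all_algebra.
From mathcomp Require Import all_classical all_reals all_analysis.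
From mathcomp Require Import ring lra.
Import Order.TTheory GRing.Theory Num.Theory.
Import numFieldNormedType.Exports.
Local Open Scope ring_scope.

(** With G the gradient of the one-layer loss at W_O W_V, the flow reads
    W_O' = - G W_V^T and W_V' = - W_O^T G, so that W_O^T W_O - W_V W_V^T is
    constant, hence zero.  For C = W_O W_V this balance turns C^T C into
    (W_V^T W_V)^2 and C C^T into (W_O W_O^T)^2, whose square roots are the
    coefficients of (W_O W_V)' = - (G W_V^T W_V + W_O W_O^T G).  Only the
    uniqueness of the positive semidefinite square root is needed, also for
    the homogeneity of Omega. *)

Section Lemmas.
Local Open Scope classical_set_scope.
Local Set Implicit Arguments.
Local Unset Strict Implicit.
Local Unset Printing Implicit Defensive.
Variable R : realType.

(** * Limits and continuity of matrix-valued functions *)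

Lemma cvg_mx (T : Type) (F : set_system T) (m n : nat)
    (f : T -> 'M[R]_(m, n)) (A : 'M[R]_(m, n)) : Filter F ->
  (forall i j, f x i j @[x --> F] --> A i j) -> f x @[x --> F] --> A.
Proof.
(* A neighbourhood of a matrix contains a product of entrywise neighbourhoods [P i j]; there are
   finitely many, so the filter controls them all at once. *)
move=> FF fA B [P AP PB]; apply: (filterS PB) => /=.
by apply: filter_forall => i; apply: filter_forall => j; exact: fA.
Qed.

Lemma cvg_coord (T : Type) (F : set_system T) (m n : nat)
    (f : T -> 'M[R]_(m, n)) (A : 'M[R]_(m, n)) i j : Filter F ->
  f x @[x --> F] --> A -> f x i j @[x --> F] --> A i j.
Proof.
by move=> FF fA; exact: (cvg_comp _ _ fA (@coord_continuous R m n i j A)).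
Qed.

(** Expanding the argument in the basis [delta_mx i j] writes [L] as a finite sum of coordinates
    times fixed vectors. *)
Lemma linear_mx_continuous (m n : nat) (V : normedModType R)
    (L : {linear 'M[R]_(m, n) -> V}) : continuous L.
Proof.
move=> A.
have -> : (L : _ -> _) = fun B => \sum_i \sum_j B i j *: L (delta_mx i j).
  apply/funext => B; rewrite {1}(matrix_sum_delta B) linear_sum.
  apply: eq_bigr => i _; rewrite linear_sum; apply: eq_bigr => j _.
  by rewrite linearZ.
apply: (@cvg_big _ _ _ _ _ _ _ (nbhs A)) => [|i _]; first exact: add_continuous.
apply: (@cvg_big _ _ _ _ _ _ _ (nbhs A)) => [|j _]; first exact: add_continuous.
exact: (@cvgZr_tmp _ _ _ (nbhs A)) (@coord_continuous R m n i j A).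
Qed.

Lemma cvg_mulmx (T : Type) (F : set_system T) (m n p : nat)
    (f : T -> 'M[R]_(m, n)) (g : T -> 'M[R]_(n, p))
    (A : 'M[R]_(m, n)) (B : 'M[R]_(n, p)) : Filter F ->
  f x @[x --> F] --> A -> g x @[x --> F] --> B ->
  f x *m g x @[x --> F] --> A *m B.
Proof.
move=> FF fA gB; apply: cvg_mx => i k; rewrite mxE.
under eq_fun do rewrite mxE.
apply: cvg_big => [|j _]; first exact: add_continuous.
by apply: cvgM; exact: cvg_coord.
Qed.

(** * Calculus of the derivative on the half-line *)

Lemma is_derive_ge0_cvg (V : normedModType R) (f : R -> V) t df :
  is_derive_ge0 f t df -> f s @[s --> within [set s | 0 <= s] t^'] --> f t.
Proof.
move=> fdf.
have st0 : s - t @[s --> within [set s | 0 <= s] t^'] --> 0.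
  rewrite -(subrr t); apply: cvgB; last exact: cvg_cst.
  exact: (cvg_trans (cvg_within _ (F := t^')) (cvg_within _)).
(* Away from [s = t] this expression is [f s], and the filter is punctured at [t]. *)
have lim : (s - t) *: ((s - t)^-1 *: (f s - f t)) + f t
    @[s --> within [set s | 0 <= s] t^'] --> 0 + f t.
  by rewrite -[X in X + _](scale0r df); apply: cvgD (cvgZ st0 fdf) (cvg_cst _).
rewrite -[X in _ --> X]add0r; apply: cvg_trans lim; apply: near_eq_cvg.
near=> s; rewrite scalerA divff ?scale1r ?subrK // subr_eq0.
near: s; apply: (cvg_within _ (F := t^')); exact: withinT.
Unshelve. all: by end_near. Qed.

Lemma is_derive_ge0_linear (m n : nat) (V : normedModType R)
    (L : {linear 'M[R]_(m, n) -> V}) f t df :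
  is_derive_ge0 f t df -> is_derive_ge0 (L \o f) t (L df).
Proof.
move=> fdf; rewrite /is_derive_ge0 /=.
under eq_fun do rewrite -linearB -linearZ.
by apply: (cvg_comp _ L fdf); exact: linear_mx_continuous.
Qed.

Lemma is_derive_ge0B (V : normedModType R) (f g : R -> V) t df dg :
  is_derive_ge0 f t df -> is_derive_ge0 g t dg ->
  is_derive_ge0 (fun s => f s - g s) t (df - dg).
Proof.
move=> fdf gdg; rewrite /is_derive_ge0.
under eq_fun do rewrite opprD addrACA -opprD scalerBr.
exact: cvgB fdf gdg.
Qed.

Lemma is_derive_ge0_mulmx (m n p : nat) (f : R -> 'M[R]_(m, n))
    (g : R -> 'M[R]_(n, p)) t df dg :
  is_derive_ge0 f t df -> is_derive_ge0 g t dg ->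
  is_derive_ge0 (fun s => f s *m g s) t (df *m g t + f t *m dg).
Proof.
move=> fdf gdg; rewrite /is_derive_ge0.
(* Taking [g] at [s] but [f] at [t] leaves continuity of [g] as the only extra limit. *)
have E s : (s - t)^-1 *: (f s *m g s - f t *m g t) =
    ((s - t)^-1 *: (f s - f t)) *m g s + f t *m ((s - t)^-1 *: (g s - g t)).
  by rewrite -scalemxAl -scalemxAr -scalerDr mulmxBl mulmxBr addrA subrK.
under eq_fun do rewrite E.
apply: cvgD; apply: cvg_mulmx => //; last exact: cvg_cst.
exact: is_derive_ge0_cvg gdg.
Qed.

Lemma is_derive_ge0_coord (m n : nat) (f : R -> 'M[R]_(m, n)) t df
    (i : 'I_m) (j : 'I_n) :
  is_derive_ge0 f t df -> is_derive_ge0 (fun s => f s i j) t (df i j).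
Proof.
move=> fdf; rewrite /is_derive_ge0.
have E s : (s - t)^-1 *: (f s i j - f t i j) = ((s - t)^-1 *: (f s - f t)) i j.
  by rewrite !mxE.
under eq_fun do rewrite E.
exact: cvg_coord.
Qed.

(** Since [0 < t], the constraint [0 <= s] is vacuous near [t]. *)
Lemma is_derive_ge0_is_derive (V : normedModType R) (f : R -> V) t df :
  0 < t -> is_derive_ge0 f t df -> is_derive t 1 f df.
Proof.
move=> t0 fdf.
have shift_t : h + t @[h --> 0^'] --> within [set s | 0 <= s] t^'.
  move=> A /= tA; have c0 : h + t @[h --> 0] --> 0 + t.
    by apply: cvgD; [exact: cvg_id|exact: cvg_cst].
  rewrite add0r in c0; have := c0 _ tA; have := c0 _ (lt_nbhsr t0).
  rewrite !near_simpl /= => pos; apply: filter_app.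
  apply: filterS pos => h /= ht0 hA h0; apply: hA; last exact: ltW.
  by rewrite -subr_eq0 addrK.
have q : h^-1 *: ((f \o shift t) (h *: 1) - f t) @[h --> 0^'] --> df.
  under eq_fun do rewrite /= [_ *: 1]mulr1.
  have := cvg_comp _ _ shift_t fdf.
  by rewrite /comp /=; under eq_fun do rewrite addrK.
by apply: DeriveDef; [exact: cvgP q|exact: cvg_lim q].
Qed.

Lemma is_derive_ge0_0_cst (f : R -> R) :
  (forall t, 0 <= t -> is_derive_ge0 f t 0) -> forall t, 0 <= t -> f t = f 0.
Proof.
move=> f0 t; rewrite le_eqVlt => /predU1P[<-//|t0].
have : exists2 c, c \in `]0, t[%R & f t - f 0 = (fun=> 0 : R) c * (t - 0).
  apply: (@MVT R f (fun=> 0) 0 t) => //.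
    move=> s; rewrite in_itv /= => /andP[s0 _].
    exact: is_derive_ge0_is_derive s0 (f0 _ (ltW s0)).
  (* At the endpoint 0 only continuity within the interval is available. The filter of
     [is_derive_ge0] omits [s] itself, so the case [u = s] is treated apart. *)
  apply/subspace_continuousP => s; rewrite /= in_itv /= => /andP[s0 _] B fB.
  have sB : \forall u \near s, u != s -> 0 <= u -> B (f u).
    exact: is_derive_ge0_cvg (f0 s s0) _ fB.
  suff : \forall u \near s, `[0, t]%classic u -> B (f u) by [].
  apply: filterS sB => u /= uB; rewrite in_itv /= => /andP[u0 _].
  by have [->|us] := eqVneq u s; [exact: nbhs_singleton|exact: uB].
by case=> c _; rewrite mul0r => /eqP; rewrite subr_eq0 => /eqP.
Qed.

(** * Positive semidefinite matrices and their square roots *)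

Lemma tr_mulmx_ge0 (m n : nat) (A : 'M[R]_(m, n)) (i : 'I_n) :
  0 <= (A^T *m A) i i.
Proof. by rewrite mxE sumr_ge0 // => j _; rewrite mxE -expr2 sqr_ge0. Qed.

Lemma psd_gram (m n : nat) (A : 'M[R]_(m, n)) : psd (A^T *m A).
Proof.
split=> [|v]; first by rewrite trmx_mul trmxK.
by rewrite -mulmxA -mulmxA mulmxA -trmx_mul tr_mulmx_ge0.
Qed.

Lemma tr_mulmx_eq0 (m n : nat) (A : 'M[R]_(m, n)) :
  (forall i, (A^T *m A) i i = 0) -> A = 0.
Proof.
move=> A0; apply/matrixP => i j; rewrite mxE; have /eqP := A0 j.
rewrite mxE psumr_eq0 => [/allP/(_ i)|k _]; last by rewrite mxE -expr2 sqr_ge0.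
by rewrite mem_index_enum mxE -expr2 sqrf_eq0 => /(_ isT)/eqP.
Qed.

Lemma quadratic_ge0_eq0 (a b : R) : 0 <= a -> 0 <= b ->
  (forall e, 0 <= e * a *+ 2 + e ^+ 2 * b) -> a = 0.
Proof.
move=> a0 b0 q; have [//|/eqP a_neq0] := eqVneq a 0.
have a_gt0 : 0 < a by rewrite lt_def a0 andbT; exact/eqP.
have c0 : 0 < b + 1 by lra.
(* A negative [e] near the minimizer [- a / b]; the 1 keeps the denominator positive when [b = 0].
   The value there is negative if [0 < a]. *)
have := q (- (a / (b + 1))).
suff -> : - (a / (b + 1)) * a *+ 2 + (- (a / (b + 1))) ^+ 2 * b =
    - ((a / (b + 1)) ^+ 2 * (b + 2)).
  have : 0 < (a / (b + 1)) ^+ 2 * (b + 2).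
    by rewrite mulr_gt0 ?exprn_gt0 ?divr_gt0 //; lra.
  lra.
field; lra.
Qed.

(** Along [v + e *: w] with [w = S *m v], the form has no constant term and its linear coefficient
    is twice the squared norm of [w]; nonnegativity for both signs of [e] forces that norm to
    vanish. *)
Lemma psd_isotropic (n : nat) (S : 'M[R]_n) (v : 'cV[R]_n) :
  psd S -> (v^T *m S *m v) 0 0 = 0 -> S *m v = 0.
Proof.
move=> [Ssym Sge0] v0; apply: tr_mulmx_eq0 => i; rewrite !ord1.
set w := S *m v; set a := _ 0 0; set b := (w^T *m S *m w) 0 0.
have a0 : 0 <= a by exact: tr_mulmx_ge0.
have b0 : 0 <= b by exact: Sge0.
have q e : 0 <= e * a *+ 2 + e ^+ 2 * b.
  have := Sge0 (v + e *: w).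
  have wSv : (w^T *m S *m v) 0 0 = a by rewrite -mulmxA.
  have vSw : (v^T *m S *m w) 0 0 = a.
    by rewrite /a {2}/w trmx_mul Ssym.
  have -> : (v + e *: w)^T = v^T + e *: w^T.
    by apply/matrixP => i' j; rewrite !mxE.
  rewrite !mulmxDl !mulmxDr -!scalemxAl -!scalemxAr.
  rewrite /b; move: (v^T *m S *m v) v0 (v^T *m S *m w) vSw.
  move: (w^T *m S *m v) wSv (w^T *m S *m w).
  move=> Q1 + Q2 Q3 + Q4 +; rewrite !mxE => -> -> ->.
  by rewrite add0r expr2 mulr2n addrA mulrA.
exact: quadratic_ge0_eq0 a0 b0 q.
Qed.

(* With D = S - T, both D S D and D T D are positive semidefinite and their
   traces add up to tr (D (S^2 - T^2)) = 0, so S D = T D = 0 and D^2 = 0. *)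
Lemma psd_sqr_inj (n : nat) (S T : 'M[R]_n) :
  psd S -> psd T -> S *m S = T *m T -> S = T.
Proof.
move=> pS pT ST; set D := S - T.
have Dsym : D^T = D by rewrite linearB /= pS.1 pT.1.
have dE (A : 'M[R]_n) i : (D *m A *m D) i i = ((col i D)^T *m A *m col i D) 0 0.
  rewrite -{1}Dsym tr_col -row_mul !mxE.
  by apply: eq_bigr => j _; rewrite [row _ _ _ _]mxE [col _ _ _ _]mxE.
have tr0 : \tr (D *m S *m D) + \tr (D *m T *m D) = 0.
  rewrite -mulmxA (mxtrace_mulC (D *m T)) -mxtraceD -mulmxDr.
  suff -> : S *m D + D *m T = 0 by rewrite mulmx0 mxtrace0.
  by rewrite mulmxBr mulmxBl addrA subrK ST subrr.
(* The diagonal entries of [D *m A *m D] are the values of the form of [A] at the columns of [D]. If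
   their sum is 0, each is 0, and [psd_isotropic] shows that [A] kills every column. *)
have D0 A : psd A -> \tr (D *m A *m D) = 0 -> A *m D = 0.
  move=> pA /eqP; rewrite psumr_eq0 => [/allP trA|i _]; last first.
    by rewrite dE; apply: pA.2.
  apply/matrixP => i j; have := psd_isotropic pA (v := col j D).
  rewrite -dE => /(_ (eqP (trA j (mem_index_enum _)))) /colP /(_ i).
  by rewrite colE mulmxA -colE !mxE.
have trge0 A : psd A -> 0 <= \tr (D *m A *m D).
  by move=> pA; apply: sumr_ge0 => i _; rewrite dE; apply: pA.2.
have /eqP := tr0; rewrite paddr_eq0 ?trge0 // => /andP[/eqP/D0 SD /eqP/D0 TD].
suff : D = 0 by move/eqP; rewrite subr_eq0 => /eqP.
by apply: tr_mulmx_eq0 => i; rewrite Dsym mulmxBl SD // TD // subr0 mxE.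
Qed.

Lemma psd_sqrtE (n : nat) (S : 'M[R]_n) : psd S -> psd_sqrt (S *m S) = S.
Proof.
move=> pS; apply: xget_unique => // T [pT TT]; exact: psd_sqr_inj.
Qed.

Lemma psdZ (n : nat) (c : R) (S : 'M[R]_n) : 0 <= c -> psd S -> psd (c *: S).
Proof.
move=> c0 [Ssym Sge0]; split=> [|v]; first by rewrite linearZ /= Ssym.
by rewrite -scalemxAr -scalemxAl mxE mulr_ge0.
Qed.

(** For [0 < c], scaling by [c] is a bijection from the psd roots of [P] to those of [c ^+ 2 *: P];
    hence if [P] has no such root, both sides are the default value 0. *)
Lemma psd_sqrtZ (n : nat) (c : R) (P : 'M[R]_n) :
  0 <= c -> psd_sqrt (c ^+ 2 *: P) = c *: psd_sqrt P.
Proof.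
have ZZ (a : R) (S : 'M[R]_n) : (a *: S) *m (a *: S) = a ^+ 2 *: (S *m S).
  by rewrite -scalemxAl -scalemxAr scalerA -expr2.
rewrite le_eqVlt => /predU1P[<-|c0].
  rewrite expr0n /= !scale0r.
  rewrite -[X in psd_sqrt X](mul0mx _ (0 : 'M[R]_n)) psd_sqrtE //.
  by split=> [|v]; rewrite ?trmx0 // mulmx0 mul0mx mxE.
rewrite {2}/psd_sqrt; case: xgetP => [S _ [pS <-]|nP].
  by rewrite -ZZ psd_sqrtE //; exact: psdZ (ltW c0) pS.
rewrite scaler0 /psd_sqrt; case: xgetP => // S _ [pS SS].
case: (nP (c^-1 *: S)); split; first by apply: psdZ => //; rewrite invr_ge0 ltW.
by rewrite ZZ SS scalerA -exprMn mulVf ?gt_eqF // expr1n scale1r.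
Qed.

(** * Homogeneity of [Omega] and vectorization of matrix products *)

Lemma tensmxZr (m n p q : nat) (c : R) (A : 'M[R]_(m, n)) (B : 'M[R]_(p, q)) :
  A *t (c *: B) = c *: (A *t B).
Proof. by apply/matrixP => i j; rewrite !mxE mulrCA. Qed.

Lemma tensmxZl (m n p q : nat) (c : R) (A : 'M[R]_(m, n)) (B : 'M[R]_(p, q)) :
  (c *: A) *t B = c *: (A *t B).
Proof. by apply/matrixP => i j; rewrite !mxE mulrA. Qed.

Lemma OmegaZ (M d : nat) (c : R) (C : 'M[R]_(M, d)) :
  0 <= c -> Omega (c *: C) = c *: Omega C.
Proof.
move=> c0; rewrite /Omega /kronecker_sum.
have -> : (c *: C)^T = c *: C^T by rewrite linearZ.
rewrite -!scalemxAl -!scalemxAr !scalerA -expr2 !psd_sqrtZ //.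
by rewrite tensmxZl tensmxZr scalerDr.
Qed.

(** Stacking columns makes the column index the block index, so the right factor [B] acts on blocks,
    transposed. The sum over positions becomes a double sum over pairs (column, row). *)
Lemma vec_mulmx (m n p q : nat)
    (A : 'M[R]_(m, n)) (X : 'M[R]_(n, p)) (B : 'M[R]_(p, q)) :
  vec (A *m X *m B) = (B^T *t A) *m vec X.
Proof.
apply/colP => k; case: (mxtens_indexP k) => j i.
rewrite vecE [RHS]mxE.
rewrite (reindex (@mxtens_index _ _)) /=; last first.
  exists (@mxtens_unindex _ _) => l _; first exact: mxtens_indexK.
  exact: mxtens_unindexK.
rewrite [RHS](eq_bigr (fun lk =>
  A i lk.2 * X lk.2 lk.1 * B lk.1 j)); last first.
  by case=> l h _; rewrite tensmxE vecE mxE -mulrA mulrC.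
rewrite -(pair_bigA _ (fun l k => A i k * X k l * B l j)) mxE /=.
by apply: eq_bigr => l _; rewrite mxE mulr_suml.
Qed.

(** * Differentiability of the loss and gradients through a product *)

Lemma loss1_differentiable (M d : nat) (x : 'cV[R]_d) (y : 'I_M) W :
  differentiable (loss1 x y) W.
Proof.
pose u i (W : 'M[R]_(M, d)) := expR ((W *m x) i 0).
have du i : differentiable (u i) W.
  apply: (@differentiable_comp _ _ _ _
    (fun W : 'M[R]_(M, d) => (W *m x) i 0) expR).
    apply: (@differentiable_comp _ _ _ _ (mulmxr x)
      (fun v : 'cV[R]_M => v i 0)).
      exact/linear_differentiable/linear_mx_continuous.
    exact: differentiable_coord.
  exact/derivable1_diffP/derivable_expR.
have u_gt0 i V : 0 < u i V by exact: expR_gt0.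
(* The index [y] makes the sum nonempty. Positivity serves twice: for the inverse of the denominator
   and for the argument of [ln]. *)
have s_gt0 V : 0 < \sum_i u i V.
  by rewrite (bigD1 y) //= ltr_pwDl // sumr_ge0 // => i _; exact: ltW.
rewrite (_ : loss1 x y = - (@ln R \o (fun W => softmax (W *m x) y))) //.
apply: differentiableN.
apply: (@differentiable_comp _ _ _ R^o
  (fun W : 'M[R]_(M, d) => softmax (W *m x) y) (@ln R)).
  apply: differentiableM; first exact: du.
  apply: (@differentiableV _ _ (fun W => \sum_i u i W)).
    rewrite (_ : (fun _ => _) = \sum_i u i); first exact: differentiable_sum.
    by apply/funext => V; rewrite fct_sumE.
  by rewrite gt_eqF.
apply/derivable1_diffP; apply: ex_derive; apply: is_derive1_ln.
exact: divr_gt0 (expR_gt0 _) (s_gt0 W).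
Qed.

Lemma mxtrace_tr_delta (m n : nat) (A : 'M[R]_(m, n)) i j :
  \tr (A^T *m delta_mx i j) = A i j.
Proof.
rewrite mxtrace_mulC /mxtrace (bigD1 i) //= big1 => [|k ki].
  rewrite addr0 mxE (bigD1 j) //= big1 => [|k kj].
    by rewrite !mxE !eqxx mul1r addr0.
  by rewrite !mxE (negbTE kj) andbF mul0r.
by rewrite mxE big1 // => l _; rewrite mxE (negbTE ki) mul0r.
Qed.

(** The chain rule, in the form that exhibits the adjoint of [L] for the Frobenius product. For
    multiplication by a fixed matrix, the adjoint is multiplication by its transpose on the same
    side. *)
Lemma gradient_comp (m n p q : nat) (f : 'M[R]_(p, q) -> R)
    (L : {linear 'M[R]_(m, n) -> 'M[R]_(p, q)}) W i j :
  differentiable f (L W) ->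
  gradient (f \o L) W i j = \tr ((gradient f (L W))^T *m L (delta_mx i j)).
Proof.
move=> df; have Lc := @linear_mx_continuous _ _ _ L.
rewrite mxE diff_comp ?diff_lin //= ?gradientP //.
exact: linear_differentiable.
Qed.

Lemma gradient_mulmxr (m n p : nat) (f : 'M[R]_(m, p) -> R)
    (B : 'M[R]_(n, p)) (U : 'M[R]_(m, n)) :
  differentiable f (U *m B) ->
  gradient (fun U => f (U *m B)) U = gradient f (U *m B) *m B^T.
Proof.
move=> df; apply/matrixP => i j.
rewrite (@gradient_comp _ _ _ _ f (mulmxr B)) //=.
move: (gradient f _) => G; rewrite -(mxtrace_tr_delta (G *m B^T)).
by rewrite trmx_mul trmxK mulmxA mxtrace_mulC mulmxA.
Qed.

Lemma gradient_mulmx (m n p : nat) (f : 'M[R]_(m, p) -> R)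
    (A : 'M[R]_(m, n)) (V : 'M[R]_(n, p)) :
  differentiable f (A *m V) ->
  gradient (fun V => f (A *m V)) V = A^T *m gradient f (A *m V).
Proof.
move=> df; apply/matrixP => i j.
rewrite (@gradient_comp _ _ _ _ f (mulmx A)) //=.
move: (gradient f _) => G; rewrite -(mxtrace_tr_delta (A^T *m G)).
by rewrite trmx_mul trmxK mulmxA.
Qed.

(** * Linearity of [vec], and [Omega] at a balanced factorization *)

Lemma vec_is_linear (m n : nat) : linear (@vec R m n).
Proof. by move=> c A B; apply/colP => k; rewrite !mxE. Qed.

(** Makes [is_derive_ge0_linear] applicable to [vec]. *)
HB.instance Definition _ (m n : nat) :=
  GRing.isLinear.Build R 'M[R]_(m, n) 'cV[R]_(n * m) _ (@vec R m n)
    (@vec_is_linear m n).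

Lemma Omega_balanced (m n p : nat) (A : 'M[R]_(m, n)) (B : 'M[R]_(n, p)) :
  A^T *m A = B *m B^T ->
  Omega (A *m B) = kronecker_sum (B^T *m B) (A *m A^T).
Proof.
move=> AB; rewrite /Omega trmx_mul; congr kronecker_sum.
  (* Written as the root of its own square, the Gram matrix is compared through radicands:
     [B^T A^T A B] and [B^T B B^T B] differ only in the middle, where balance applies. *)
  rewrite -[RHS](psd_sqrtE (psd_gram B)); congr psd_sqrt.
  by rewrite !mulmxA; congr (_ *m B); rewrite -!mulmxA; congr (B^T *m _).
have psdA : psd (A *m A^T) by rewrite -[X in X *m _]trmxK; exact: psd_gram.
rewrite -[RHS](psd_sqrtE psdA); congr psd_sqrt.
by rewrite !mulmxA; congr (_ *m A^T); rewrite -!mulmxA AB.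
Qed.

(** Two cases of [vec_mulmx] with an identity factor; symmetry absorbs the transpose it puts on
    [A]. *)
Lemma kronecker_sum_vec (m n : nat) (A : 'M[R]_n) (B : 'M[R]_m)
    (X : 'M[R]_(m, n)) :
  A^T = A -> kronecker_sum A B *m vec X = vec (X *m A + B *m X).
Proof.
move=> Asym; rewrite mulmxDl linearD /=; congr (_ + _).
  by rewrite -[X *m A]mul1mx mulmxA vec_mulmx Asym.
by rewrite -[B *m X]mulmx1 vec_mulmx trmx1.
Qed.

(** * Gradient flow on a product of two matrices *)

Section TwoLayerFlow.
Variables (m n p : nat) (f : 'M[R]_(m, p) -> R).
Variables (A : R -> 'M[R]_(m, n)) (B : R -> 'M[R]_(n, p)).
Let G t := gradient f (A t *m B t).
Hypothesis dA : forall t, 0 <= t -> is_derive_ge0 A t (- (G t *m (B t)^T)).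
Hypothesis dB : forall t, 0 <= t -> is_derive_ge0 B t (- ((A t)^T *m G t)).

(** Both [A^T A] and [B B^T] have derivative [- (B G^T A + A^T G B^T)]. The difference is shown
    constant entry by entry, because the mean value argument is for real functions. *)
Lemma flow_balanced : (A 0)^T *m A 0 = B 0 *m (B 0)^T ->
  forall t, 0 <= t -> (A t)^T *m A t = B t *m (B t)^T.
Proof.
move=> AB0 t t0; apply/eqP; rewrite -subr_eq0; apply/eqP/matrixP => i j.
pose D s := (A s)^T *m A s - B s *m (B s)^T.
have D0 s : 0 <= s -> is_derive_ge0 D s 0.
  move=> s0.
  have dAT := @is_derive_ge0_linear _ _ _ trmx _ _ _ (dA s0).
  have dBT := @is_derive_ge0_linear _ _ _ trmx _ _ _ (dB s0).
  have := is_derive_ge0B (is_derive_ge0_mulmx dAT (dA s0))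
                         (is_derive_ge0_mulmx (dB s0) dBT).
  rewrite /= !linearN /= !trmx_mul !trmxK !mulNmx !mulmxA.
  by rewrite [X in _ - X]addrC subrr.
transitivity (D 0 i j); last by rewrite /D AB0 subrr.
apply: (is_derive_ge0_0_cst (f := fun s => D s i j)) => // s s0.
by have := @is_derive_ge0_coord _ _ D s 0 i j (D0 s s0); rewrite mxE.
Qed.

Lemma flow_vec_product : (A 0)^T *m A 0 = B 0 *m (B 0)^T ->
  forall t, 0 <= t -> is_derive_ge0 (fun s => vec (A s *m B s)) t
    (- (Omega (A t *m B t) *m vec (G t))).
Proof.
move=> AB0 t t0; rewrite Omega_balanced; last exact: flow_balanced.
(* The target becomes the [vec] of [- G B^T B - A A^T G], which is what the product rule gives for
   [A B]. *)
rewrite kronecker_sum_vec ?trmx_mul ?trmxK // -linearN opprD !mulmxA.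
have := is_derive_ge0_mulmx (dA t0) (dB t0).
rewrite mulNmx mulmxN !mulmxA.
exact: (@is_derive_ge0_linear _ _ _ (@vec R m p)).
Qed.

End TwoLayerFlow.

End Lemmas.

Theorem lemma2 (R : realType) (M d : nat) (hM : (1 <= M)%N) (hd : (1 <= d)%N) :
  (forall (x : 'cV[R]_d) (y : 'I_M)
      (WO : R -> 'M[R]_(M, d)) (WV : R -> 'M[R]_d),
    (forall t : R, 0 <= t ->
      is_derive_ge0 WO t
        (- gradient (fun U : 'M[R]_(M, d) => loss2 x y U (WV t)) (WO t))) ->
    (forall t : R, 0 <= t ->
      is_derive_ge0 WV t
        (- gradient (fun V : 'M[R]_d => loss2 x y (WO t) V) (WV t))) ->
    (WO 0)^T *m WO 0 = WV 0 *m (WV 0)^T ->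
    forall t : R, 0 <= t ->
      is_derive_ge0 (fun s : R => vec (WO s *m WV s)) t
        (- (Omega (WO t *m WV t)
              *m vec (gradient (loss1 x y) (WO t *m WV t))))) /\
  (forall (c : R) (C : 'M[R]_(M, d)), 0 <= c -> Omega (c *: C) = c *: Omega C).
Proof.
split=> [x y WO WV dWO dWV balanced t t0|c C]; last exact: OmegaZ.
apply: (@flow_vec_product R M d d (loss1 x y) WO WV) => // s s0.
  (* [loss2 x y U V] unfolds to [loss1 x y (U *m V)], so the partial gradients in the flow are
     gradients through a product. *)
  rewrite -gradient_mulmxr; [exact: dWO|exact: loss1_differentiable].
rewrite -gradient_mulmx; [exact: dWV|exact: loss1_differentiable].
Qed.
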